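(* Let $I\subseteq\mathbb{R}$ be an interval with $0\in I$, and let $\mathbf f=(f_1,\dots,f_n)$ be a system of real analytic functions on $I$ such that each $f_k$ equals the sum of its Maclaurin series on $I$. Let $x_1<x_2<\cdots<x_n$ be points of $I$ and let $M=M_{\mathbf f,\mathbf x}=(f_c(x_r))_{r,c=1}^n$ be the collocation matrix. Then for all $0<j\le i\le n$, \[ \det M[i-j+1,\dots,i\mid 1,\dots,j]=V(x_{i-j+1},\dots,x_i)\sum_{\lambda}\frac{1}{C_\lambda}\,W^t_{\mathbf f}[j,\lambda]\,s_\lambda(x_{i-j+1},\dots,x_i), \] and \[ \det M^t[i-j+1,\dots,i\mid 1,\dots,j]=V(x_1,\dots,x_j)\sum_{\lambda}\frac{1}{C_\lambda}\,W^t_{\mathbf f}[i,\lambda]\,s_\lambda(x_1,\dots,x_j), \] where in both formulas the sum runs over all integer partitions $\lambda$ (partitions with more than $j$ parts contribute $0$, since $s_\lambda$ of $j$ variables vanishes for them), and for a partition $\lambda$ with at most $j$ parts, written as $\lambda=(\lambda_1,\dots,\lambda_j)$ with $\lambda_1\ge\cdots\ge\lambda_j\ge 0$ (padded by zeros), \[ C_\lambda:=\lambda_j!\,(\lambda_{j-1}+1)!\cdots(\lambda_1+j-1)!. \]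
   Context: For a matrix $A$, $A[i_1,\dots,i_r\mid j_1,\dots,j_s]$ denotes the submatrix with rows $i_1,\dots,i_r$ and columns $j_1,\dots,j_s$; $A^t$ is the transpose. The infinite Wronskian of $\mathbf f$ at $0$ is $W_{\mathbf f}=(f_c^{(r-1)}(0))_{1\le r<\infty,\,1\le c\le n}$, so $W^t_{\mathbf f}$ is the $n\times\infty$ matrix whose $(c,k+1)$ entry is $f_c^{(k)}(0)$. For a matrix $A$, an index $i$ with $j\le i$, and a partition $\lambda=(\lambda_1\ge\cdots\ge\lambda_j\ge 0)$, set $A[i,\lambda]:=\det A[i-j+1,\dots,i\mid \lambda_j+1,\lambda_{j-1}+2,\dots,\lambda_1+j]$ (the column indices are $\lambda_{j-m+1}+m$, $m=1,\dots,j$). The Vandermonde determinant is $V(y_1,\dots,y_m):=\det(y_c^{m-r})_{r,c=1}^m$. The Schur polynomial of a partition $\lambda=(\lambda_1\ge\cdots\ge\lambda_m\ge0)$ with at most $m$ parts is $s_\lambda(y_1,\dots,y_m):=\det(y_c^{\lambda_r+m-r})_{r,c=1}^m/V(y_1,\dots,y_m)$, and $s_\lambda(y_1,\dots,y_m):=0$ if $\lambda$ has more than $m$ nonzero parts.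
   Formalization: A factor (-1)^{j(j-1)/2} is put before V in both formulas, which are otherwise false (n=i=j=2, f=(1,x)); the sum over partitions is the limit over boxes (at most N parts, all at most N), and also unordered at interior points of I or where the series converge absolutely. *)

(* Defs.v *)
From HB Require Import structures.
From mathcomp Require Import all_boot all_order all_algebra.
From mathcomp Require Import finmap.
From mathcomp Require Import all_classical all_reals all_analysis.

Set Implicit Arguments.
Unset Strict Implicit.
Unset Printing Implicit Defensive.

Import Order.TTheory GRing.Theory Num.Theory.
Import numFieldNormedType.Exports.

Local Open Scope classical_set_scope.
Local Open Scope ring_scope.

(* All matrices are indexed from 0: row r and column k stand for row r + 1   *)
(* and column k + 1 of the usual 1-based numbering.                          *)

Section Partitions.

Record intpart := IntPart {
  parts : seq nat;
  _ : sorted geq parts && (0%N \notin parts) }.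

HB.instance Definition _ := [isSub for parts].
HB.instance Definition _ := [Countable of intpart by <:].

(* lambda_(k + 1), with the parts padded by zeros. *)
Definition part (l : intpart) (k : nat) : nat := nth 0%N (parts l) k.

(* Partitions with at most N parts, all of them at most N. *)
Definition partition_box (N : nat) : set intpart :=
  [set l | (size (parts l) <= N)%N && all (fun p => (p <= N)%N) (parts l)].

(* \sum_(i \in A) F i is a genuine sum only if A meets the support of F in   *)
(* a finite set, which this guarantees.                                      *)
Lemma partition_box_finite N : finite_set (partition_box N).
Proof.
pose g m (t : m.-tuple 'I_N.+1) : seq nat := [seq nat_of_ord i | i <- tval t].
pose D := allpairs_dep g (iota 0 N.+1) (fun m => enum {: m.-tuple 'I_N.+1}).
apply: (@sub_finite_set _ _ (parts @^-1` [set` D])); last first.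
  by apply: finite_preimage; [move=> a b _ _ /val_inj | exact: finite_seq].
move=> l /= /andP[sl /allP al]; apply/allpairsPdep.
exists (size (parts l)), (map_tuple (@inord N) (in_tuple (parts l))).
split; [by rewrite mem_iota | by rewrite mem_enum |].
rewrite /g /= -map_comp -[LHS]map_id; apply/eq_in_map => p pl /=.
by rewrite inordK // ltnS; apply: al.
Qed.

End Partitions.

Section PartitionSums.
Context {R : realType}.
Implicit Types (F : intpart -> R) (s : R).

Definition box_sum F s :=
  (fun N : nat => \sum_(l \in partition_box N) F l) @ \oo --> s.

Definition unordered_sum F s :=
  forall e : R, 0 < e -> exists S0 : {fset intpart},
    forall S : {fset intpart}, (S0 `<=` S)%fset ->
      `|\sum_(l <- S) F l - s| < e.

(* s is the sum of F over all partitions. At an endpoint of the common       *)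
(* interval, Maclaurin series may converge only conditionally (already       *)
(* ln (1 + x) at x = 1), and then no unordered sum exists; the sum is        *)
(* taken along the boxes. Under uncond it is moreover independent of the     *)
(* order of summation.                                                       *)
Definition partition_sum (uncond : Prop) F s :=
  box_sum F s /\ (uncond -> unordered_sum F s).

End PartitionSums.

Section Wronskian.
Context {R : realType}.
Implicit Types (I : set R) (f : R -> R).

(* Derivatives are relative to I, hence one-sided at an endpoint of I; this  *)
(* matters at 0 when 0 is an endpoint.                                       *)
Definition derive_in I f : R -> R :=
  fun x => lim ((fun y => (f y - f x) / (y - x)) @ within I x^').

Definition derive_in_n I (k : nat) f : R -> R := iter k (derive_in I) f.

Definition analytic_on I f := forall a, I a ->
  exists c : R^nat, exists2 e : R, 0 < e &
    forall x, I x -> `|x - a| < e ->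
      [series c k * (x - a) ^+ k]_k @ \oo --> f x.

Definition maclaurin_term I f (x : R) (k : nat) : R :=
  derive_in_n I k f 0 / k`!%:R * x ^+ k.

Definition maclaurin_on I f := forall x, I x ->
  series (maclaurin_term I f x) @ \oo --> f x.

Context {n : nat}.
Implicit Types (F : 'I_n -> R -> R).

Definition wronskian_tr I F : 'I_n -> nat -> R :=
  fun c k => derive_in_n I k (F c) 0.

(* Under maclaurin_on the first alternative implies the second, a power      *)
(* series being absolutely convergent inside its interval of convergence; so *)
(* only an endpoint of I can fail to be an abs_point.                        *)
Definition abs_point I F (x : R) :=
  I° x \/ forall c, cvgn (series (fun k => `|maclaurin_term I (F c) x k|)).

Definition collocation F (x : 'I_n -> R) : 'M[R]_n :=
  \matrix_(r, c) F c (x r).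

End Wronskian.

Section Minors.

Lemma window_subproof (n i j : nat) (hji : (j <= i)%N) (hin : (i <= n)%N)
  (r : 'I_j) : (i - j + r < n)%N.
Proof.
apply: leq_trans hin; rewrite -[ltnRHS](subnK hji).
by rewrite ltn_add2l.
Qed.

(* The 1-based indices i - j + 1, ..., i. *)
Definition window (n i j : nat) (hji : (j <= i)%N) (hin : (i <= n)%N) :
  'I_j -> 'I_n := fun r => Ordinal (window_subproof hji hin r).

Context {R : comNzRingType}.

(* A[i, lambda]: column c is the 1-based column lambda_(j - c) + c + 1, and   *)
(* rev_ord c = j - c - 1.                                                    *)
Definition part_minor (n i j : nat) (hji : (j <= i)%N) (hin : (i <= n)%N)
    (A : 'I_n -> nat -> R) (l : intpart) : R :=
  \det (\matrix_(r < j, c < j) A (window hji hin r) (part l (rev_ord c) + c)%N).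

End Minors.

Section Schur.
Context {R : realType}.

(* The product of y r - y c over r < c. The product of y c - y r, positive   *)
(* for increasing y, is (-1) ^+ 'C(m, 2) times this; that is the one arising *)
(* from increasing column indices, as in part_minor.                         *)
Definition vandermonde (m : nat) (y : 'I_m -> R) : R :=
  \det (\matrix_(r < m, c < m) y c ^+ (m - r.+1)).

(* The value of the Schur polynomial at pairwise distinct y; the quotient is *)
(* 0 by convention if two of the y coincide.                                 *)
Definition schur (l : intpart) (m : nat) (y : 'I_m -> R) : R :=
  if (size (parts l) <= m)%N then
    \det (\matrix_(r < m, c < m) y c ^+ (part l r + (m - r.+1)))
      / vandermonde y
  else 0.

Definition Cpart (j : nat) (l : intpart) : nat :=
  (\prod_(m < j) (part l (rev_ord m) + m)`!)%N.

End Schur.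

(* Main.v *)
Require Import Defs.
From mathcomp Require Import all_boot all_order all_fingroup all_algebra.
From mathcomp Require Import finmap.
From mathcomp Require Import all_classical all_reals all_analysis.
Import Order.TTheory GRing.Theory Num.Theory.
Import numFieldNormedType.Exports.
Local Open Scope classical_set_scope.
Local Open Scope ring_scope.

Set Implicit Arguments.
Unset Strict Implicit.
Unset Printing Implicit Defensive.

(* Truncate the Maclaurin series at order N + j: the matrix (f_r(x_c))      *)
(* becomes a product of the j x (N + j) matrix of Taylor coefficients by    *)
(* the matrix of powers x_c ^ k. By Cauchy-Binet its determinant is a sum   *)
(* over increasing sequences k_0 < ... < k_(j - 1) < N + j, and these are   *)
(* the sequences k_c = lambda_(j - c) + c for the partitions lambda with at *)
(* most j parts, all at most N: the truncated determinant is exactly the    *)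
(* sum over the N-th box, and N tends to infinity. Under absolute           *)
(* convergence, the sum of the absolute values of the terms is bounded by   *)
(* permanents of the absolute series, whence unconditional convergence.     *)

(** Each term of the series is a fixed multiple of a product of two minors. Dividing a Wronskian
    minor by $C_\lambda$ divides its columns by their factorials and leaves a minor of Taylor
    coefficients ([det_part_index]). The numerator of $s_\lambda$ is a minor of powers of the $x_c$
    with its rows in reverse order; undoing this costs the sign $(-1)^{\binom j2}$, and the
    Vandermonde denominator, nonzero at distinct points, does not depend on $\lambda$
    ([schur_term_minors]). These products are exactly what [cauchy_binet_partition_box] sums over a
    box. The limit of the boxes follows from continuity of the determinant ([cvg_det]), and
    unconditional summation from a uniform bound on the absolute box sums
    ([unordered_sum_of_bounded]). The two formulas differ only in which window selects the functions
    and which the points, and in a transposition. *)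

Lemma parts_sorted (l : intpart) : sorted geq (parts l).
Proof. by case/andP: (valP l). Qed.

Lemma parts_neq0 (l : intpart) : 0%N \notin parts l.
Proof. by case/andP: (valP l). Qed.

Lemma part_nonincreasing (l : intpart) (a b : nat) :
  (a <= b)%N -> (part l b <= part l a)%N.
Proof.
move=> ab; rewrite /part; have [lb|bl] := leqP (size (parts l)) b.
  by rewrite nth_default.
apply: (@sorted_leq_nth _ geq _ _ 0%N (parts l) (parts_sorted l)) => //.
- by move=> x y z /= h1 h2; apply: leq_trans h1.
- by move=> x /=.
- by rewrite inE; apply: leq_ltn_trans bl.
Qed.

(** Parts are nonzero, so padding loses nothing: if one list were shorter, its first padded zero
    would have to be a part of the other. *)
Lemma part_inj (j : nat) (l m : intpart) :
  (size (parts l) <= j)%N -> (size (parts m) <= j)%N ->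
  (forall c : 'I_j, part l c = part m c) -> l = m.
Proof.
wlog lm : l m / (size (parts l) <= size (parts m))%N.
  move=> H lj mj E; have [h|h] := leqP (size (parts l)) (size (parts m)).
    exact: H.
  by apply/esym/H => //; exact: ltnW.
move=> lj mj E; have {}lm : size (parts l) = size (parts m).
  apply/eqP; rewrite eqn_leq lm leqNgt; apply/negP => h.
  have := E (Ordinal (leq_trans h mj)); rewrite /part /= nth_default // => e.
  by have := parts_neq0 m; rewrite e mem_nth.
apply/val_inj/(@eq_from_nth _ 0%N) => // a al.
exact: (E (Ordinal (leq_trans al lj))).
Qed.

Lemma exists_part (j : nat) (h : nat -> nat) :
  (forall a b, (a <= b < j)%N -> (h b <= h a)%N) ->
  exists2 l : intpart, (size (parts l) <= j)%N &
    forall c : 'I_j, part l c = h c.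
Proof.
move=> hdec.
suff [s [ss s0 sj sh]] : exists s, [/\ sorted geq s, 0%N \notin s,
    (size s <= j)%N & forall c, (c < j)%N -> nth 0%N s c = h c].
  have sP : sorted geq s && (0%N \notin s) by rewrite ss.
  by exists (IntPart sP) => //= c; apply: sh.
elim: j h hdec => [|j IH] h hdec; first by exists [::].
(* The list must stop at the first zero of [h]; since [h] is nonincreasing, only zeros follow. *)
have [h0|h0] := posnP (h 0%N).
  exists [::]; split=> // c cj; rewrite nth_nil; apply/esym/eqP.
  by rewrite -leqn0 -h0 hdec.
have [|s [ss s0 sj sh]] := IH (h \o S); first by move=> a b ab; apply: hdec.
exists (h 0%N :: s); split => [||//|[|c] //].
- case: s ss s0 sj sh => //= b s -> _ sj sh; rewrite andbT.
  have j0 : (0 < j)%N by apply: leq_ltn_trans sj.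
  by have /= -> := sh 0%N j0; rewrite hdec.
- by rewrite inE negb_or s0 andbT eq_sym -lt0n.
- exact: sh.
Qed.

(** * Factoring injective functions as increasing ones after a permutation *)

Section Ranks.
Variable j : nat.

(* Hence s can be read off from k \o s; conversely, ranks sort any injective *)
(* function.                                                                *)
Lemma rank_incr (k : 'I_j -> nat) (s : 'S_j) (r : 'I_j) :
  {homo k : a b / (a < b)%N} ->
  #|[set t | (k (s t) < k (s r))%N]%SET| = s r.
Proof.
move=> kI; have kE : {mono k : a b / (a < b)%N}.
  move=> a b; have [ab|ba|/val_inj->] := ltngtP a b; last by rewrite ltnn.
    exact: kI.
  by apply/negbTE; rewrite -leqNgt ltnW // kI.
rewrite (eq_card (B := [set t | (s t < s r)%N]%SET)); last first.
  by move=> t; rewrite !inE kE.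
rewrite -(card_imset _ (@perm_inj _ s)).
rewrite (_ : [set s x | x in _] = [set t : 'I_j | (t < s r)%N])%SET.
  rewrite cardsE -sum1_card (eq_bigl (fun t : 'I_j => (t < s r)%N)) //.
  by rewrite (big_ord_narrow (ltnW (ltn_ord (s r)))) sum1_card card_ord.
apply/setP => t; rewrite inE; apply/imsetP/idP => [[u]|ht].
  by rewrite inE => ? ->.
by exists (s^-1%g t); rewrite ?inE permKV.
Qed.

Lemma incr_perm_uniq (k k' : 'I_j -> nat) (s s' : 'S_j) :
  {homo k : a b / (a < b)%N} -> {homo k' : a b / (a < b)%N} ->
  k \o s =1 k' \o s' -> s = s' /\ k =1 k'.
Proof.
move=> kI k'I E; have ss : s = s'.
  apply/permP => r; apply/val_inj; rewrite /= -(rank_incr s r kI).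
  rewrite -(rank_incr s' r k'I); apply: eq_card => t; rewrite !inE.
  by have /= -> := E t; have /= -> := E r.
split=> // r; have := E (s^-1%g r).
by rewrite /= -ss permKV.
Qed.

Lemma incr_perm_exists (f : 'I_j -> nat) : injective f ->
  exists s : 'S_j, {homo f \o s : a b / (a < b)%N}.
Proof.
move=> fI; pose rk r := #|[set t | (f t < f r)%N]%SET|.
have rkI r s : (f r < f s)%N -> (rk r < rk s)%N.
  move=> rs; apply: proper_card; apply/properP; split.
    by apply/fintype.subsetP => t; rewrite !inE => /ltn_trans; apply.
  by exists r; rewrite !inE ?ltnn.
have rkj r : (rk r < j)%N.
  rewrite -[ltnRHS](card_ord j) -cardsT; apply: proper_card.
  by apply/properP; split; [exact: finset.subsetT | exists r; rewrite !inE ?ltnn].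
have oI : injective (fun r => Ordinal (rkj r)).
  move=> a b [] e; apply: fI.
  by case: (ltngtP (f a) (f b)) => // /rkI; rewrite e ltnn.
(* The rank is a permutation of the indices; its inverse lists them by increasing value of [f]. *)
exists ((perm oI)^-1)%g => a b ab /=.
set r := (_ a); set s := (_ b).
have ra : rk r = a.
  by rewrite -[in RHS](permKV (perm oI) a) permE.
have sb : rk s = b.
  by rewrite -[in RHS](permKV (perm oI) b) permE.
case: (ltngtP (f r) (f s)) => // [/rkI|/fI e].
  by rewrite ra sb ltnNge ltnW.
by move: ab; rewrite -ra -sb e ltnn.
Qed.

End Ranks.

(** * Index reversal, and increasing sequences coded by partitions *)

Lemma sign_rev_ord (n : nat) (V : pzRingType) :
  (-1) ^+ (perm (@rev_ord_inj n)) = (-1) ^+ 'C(n, 2) :> V.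
Proof.
elim: n => [|n IH].
  rewrite (_ : perm _ = 1%g) ?odd_perm1 //; apply/permP => -[] //.
(* Reversal sends 0 to the last index and reverses the rest. The lift adds [n] to the parity,
   matching the increment of the binomial coefficient. *)
rewrite (_ : perm _ = lift_perm ord0 ord_max (perm (@rev_ord_inj n))).
  by rewrite odd_lift_perm addbC binS bin1 exprD -IH signr_addb signr_odd.
apply/permP => r; rewrite permE; have [u ->|->] := unliftP ord0 r.
  rewrite lift_perm_lift permE; apply: val_inj => /=.
  by rewrite /bump /= add1n subSS leqNgt ltn_subrL (leq_trans _ (ltn_ord u)).
by rewrite lift_perm_id; apply: val_inj => /=; rewrite subn1.
Qed.

(* 0-based index of column c in A[i, lambda]. *)
Definition part_index {j : nat} (l : intpart) (c : 'I_j) : nat :=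
  (part l (rev_ord c) + c)%N.

Lemma part_index_incr (j : nat) (l : intpart) :
  {homo @part_index j l : a b / (a < b)%N}.
Proof.
move=> a b ab; rewrite /part_index -addnS leq_add //.
by apply: part_nonincreasing; rewrite leq_sub2l // ltnW.
Qed.

(** Strictly increasing naturals gain at least one per step. Hence $k_c - c$ is nondecreasing, so
    removing the staircase leaves a partition. *)
Lemma incr_gap (j : nat) (k : 'I_j -> nat) (c d : 'I_j) :
  {homo k : a b / (a < b)%N} -> (c <= d)%N -> (k c + (d - c) <= k d)%N.
Proof.
move=> kI; move: {2}(d - c)%N (erefl (d - c)%N) => e.
elim: e d => [|e IH] d dce cd.
  rewrite dce addn0; suff -> : c = d by [].
  by apply/val_inj/eqP; rewrite eqn_leq cd -subn_eq0 dce.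
have d0 : (0 < d)%N by rewrite (leq_trans _ (leq_subr c d)) // dce.
have d1j : (d.-1 < j)%N by rewrite prednK // ltnW.
have cd1 : (c <= d.-1)%N by rewrite -ltnS prednK // -subn_gt0 dce.
have e1 : (d.-1 - c)%N = e by rewrite -subn1 subnAC dce subn1.
have := IH (Ordinal d1j) e1 cd1; rewrite /= e1 dce addnS => h.
by apply: leq_ltn_trans h _; apply: kI; rewrite /= prednK.
Qed.

Lemma part_index_exists (N j : nat) (k : 'I_j.+1 -> nat) :
  {homo k : a b / (a < b)%N} -> (forall c, (k c < N + j.+1)%N) ->
  exists l : intpart, [/\ (size (parts l) <= j.+1)%N,
    all (fun p => (p <= N)%N) (parts l) & part_index l =1 k].
Proof.
(* Inverse of [part_index]: subtract the staircase and read from the last index backwards. *)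
move=> kI kN; pose h a := (k (inord (j - a)) - (j - a))%N.
have iE a : (inord (j - a) : 'I_j.+1) = (j - a)%N :> nat.
  by rewrite inordK // ltnS leq_subr.
have ck (c : 'I_j.+1) : (c <= k c)%N.
  have := @incr_gap _ _ ord0 c kI (leq0n _); rewrite subn0; apply: leq_trans.
  exact: leq_addl.
have [|l lj lh] := @exists_part j.+1 h.
  move=> a b /andP[ab _]; rewrite /h -[X in (k _ - X)%N]iE -[X in (_ <= _ - X)%N]iE.
  set c := inord (j - b); set d := inord (j - a).
  have cd : (c <= d)%N by rewrite !iE leq_sub2l.
  rewrite leq_subRL ?ck // addnBA ?ck // addnC -addnBA //.
  exact: incr_gap.
(* The last value is at most $N + j$, and the gap from [d] to the last index is at least $j - d$, so
   $k_d - d \le N$. *)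
have hN c : (h c <= N)%N.
  rewrite /h -[X in (_ - X)%N]iE leq_subLR; set d := inord _.
  have dj : (d <= j)%N by rewrite -ltnS.
  have := incr_gap kI (d := ord_max) dj => /leq_ltn_trans /(_ (kN _)).
  rewrite addnS ltnS /= => g.
  by rewrite -(leq_add2r (j - d)) [(d + N)%N]addnC -addnA subnKC.
exists l; split=> //.
  apply/(all_nthP 0%N) => a al.
  by have := lh (Ordinal (leq_trans al lj)); rewrite /part /= => ->.
move=> c; have cj : (c <= j)%N by rewrite -ltnS.
by rewrite /part_index lh /h /= subSS subKn // inord_val subnK // ck.
Qed.

(** An injective function into the first $N + j + 1$ naturals is, in a unique way, an increasing one
    after a permutation, and the increasing ones are the partitions of the box. With [Phi]
    arbitrary, this serves both the exact expansion and the absolute bound. *)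
Lemma sum_partition_box (V : nmodType) (N j : nat)
    (Phi : ('I_j.+1 -> nat) -> V) : (j < N)%N ->
  \sum_(l \in partition_box N)
    (if (size (parts l) <= j.+1)%N then
       \sum_(s : 'S_j.+1) Phi (part_index l \o s) else 0)
  = \sum_(f : {ffun 'I_j.+1 -> 'I_(N + j).+1} | injectiveb f)
      Phi (fun r => f r : nat).
Proof.
move=> jN; rewrite fsbig_finite; last exact: partition_box_finite.
(* As $j < N$, at most $j + 1$ parts already means at most $N$ parts, so only the bound on the size
   of the parts remains from the box. *)
pose P := [seq l <- fset_set (partition_box N) | (size (parts l) <= j.+1)%N].
have memP l : l \in P = (size (parts l) <= j.+1)%N && all (fun p => (p <= N)%N) (parts l).
  rewrite mem_filter in_fset_set; last exact: partition_box_finite.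
  have [lj /=|//] := leqP (size (parts l)) j.+1.
  by apply/idP/idP; rewrite inE /partition_box /= (leq_trans lj jN).
have kN l (c : 'I_j.+1) : l \in P -> (part_index l c < (N + j).+1)%N.
  rewrite memP => /andP[_ /allP lN]; rewrite ltnS leq_add //; last by rewrite -ltnS.
  rewrite /part; case: (ltnP (rev_ord c) (size (parts l))) => cl.
    by rewrite lN // mem_nth.
  by rewrite nth_default.
rewrite -big_mkcond -big_filter -/P.
pose h l (s : 'S_j.+1) : {ffun 'I_j.+1 -> 'I_(N + j).+1} :=
  [ffun r => inord (part_index l (s r))].
rewrite (eq_big_seq (fun l => \sum_s Phi (fun r => h l s r : nat))); last first.
  move=> l lP; apply: eq_bigr => s _; congr Phi; apply/funext => r /=.
  by rewrite ffunE inordK ?kN.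
rewrite -(@big_allpairs_dep _ _ _ _ _ _ h P (fun=> index_enum 'S_j.+1)
  (fun f => Phi (fun r => f r : nat))) -[RHS]big_filter.
apply/perm_big/uniq_perm.
- apply: allpairs_uniq.
  + by rewrite filter_uniq // fset_uniq.
  + exact: index_enum_uniq.
  move=> [l s] [m t] /allpairsP[[l1 s1]/= [l1P _ [-> ->]]].
  move=> /allpairsP[[m1 t1]/= [m1P _ [-> ->]]] /= /ffunP E.
  have [] := @incr_perm_uniq _ _ _ s1 t1 (@part_index_incr j.+1 l1)
    (@part_index_incr j.+1 m1).
    by move=> r; have := congr1 val (E r); rewrite /h !ffunE /= !inordK ?kN.
  move=> -> E'; congr pair.
  move: (l1P) (m1P); rewrite !memP => /andP[l1j _] /andP[m1j _].
  apply: (@part_inj j.+1) => // c.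
  have := E' (rev_ord c); rewrite /part_index rev_ordK => /eqP.
  by rewrite eqn_add2r => /eqP.
- by rewrite filter_uniq // index_enum_uniq.
move=> f; rewrite mem_filter mem_index_enum andbT; apply/idP/idP.
  move=> /allpairsP[[l s]/= [lP _ ->]]; apply/injectiveP => a b /(congr1 val).
  rewrite !ffunE /= !inordK ?kN // => e; apply: (@perm_inj _ s).
  apply/val_inj; case: (ltngtP (s a) (s b)) => // /(@part_index_incr _ l).
    by rewrite e ltnn.
  by rewrite e ltnn.
move=> /injectiveP fI.
have [s sI] := incr_perm_exists (inj_comp val_inj fI).
have [|l [lj lN lk]] := @part_index_exists N j _ sI.
  by move=> c /=; rewrite addnS ltn_ord.
apply/allpairsP; exists (l, s^-1%g); split=> /=.
- by rewrite memP lj.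
- exact: mem_index_enum.
by apply/ffunP => r; rewrite ffunE lk /= permKV inord_val.
Qed.

(** * Cauchy-Binet over a box of partitions *)

Section CauchyBinet.
Variables (R : comNzRingType) (m n : nat) (A : 'M[R]_(m, n)) (B : 'M[R]_(n, m)).

(** Expand each row of the product as a combination of rows of [B], one choice [f] per term. A
    repeated choice gives two equal rows, so only injective [f] survive. *)
Lemma det_mulmx_rect : \det (A *m B) =
  \sum_(f : {ffun 'I_m -> 'I_n} | injectiveb f)
    (\prod_r A r (f r)) * \det (rowsub f B).
Proof.
pose AB (s : 'S_m) i k := A i k * B k (s i).
transitivity (\sum_(f : {ffun 'I_m -> 'I_n}) \sum_(s : 'S_m)
    (-1) ^+ s * \prod_i AB s i (f i)).
  rewrite exchange_big; apply: eq_bigr => /= s _; rewrite -big_distrr /=.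
  congr (_ * _); rewrite -(bigA_distr_bigA (AB s)) /=.
  by apply: eq_bigr => r _; rewrite mxE.
rewrite [RHS]big_mkcond; apply: eq_bigr => f _.
transitivity ((\prod_r A r (f r)) * \det (rowsub f B)).
  rewrite big_distrr /=; apply: eq_bigr => s _.
  rewrite mulrCA big_split //=; congr (_ * (_ * _)).
  by apply: eq_bigr => r _; rewrite mxE.
case: ifPn => // /injectivePn[r1 [r2 r12 fr]].
by rewrite (determinant_alternate r12) ?mulr0 // => c; rewrite !mxE fr.
Qed.

End CauchyBinet.

Section PartitionCauchyBinet.
Variables (R : comNzRingType) (j : nat).
Variables (a : 'I_j -> nat -> R) (b : nat -> 'I_j -> R).

(** The sign of each permutation of the first determinant is absorbed by permuting the rows of the
    second. The summand then depends only on [k \o s], as [sum_partition_box] requires. *)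
Lemma det_mul_det_expand (k : 'I_j -> nat) :
  \det (\matrix_(r < j, c < j) a r (k c)) * \det (\matrix_(r < j, c < j) b (k r) c)
  = \sum_(s : 'S_j) (\prod_r a r (k (s r)))
      * \det (\matrix_(r < j, c < j) b (k (s r)) c).
Proof.
rewrite big_distrl /=; apply: eq_bigr => s _.
rewrite -mulrA mulrCA; congr (_ * _).
  by apply: eq_bigr => r _; rewrite mxE.
rewrite -det_perm -det_mulmx -row_permE; congr (\det _).
by apply/matrixP => r c; rewrite !mxE.
Qed.

End PartitionCauchyBinet.

Lemma cauchy_binet_partition_box (R : comNzRingType) (j N : nat)
    (a : 'I_j.+1 -> nat -> R) (b : nat -> 'I_j.+1 -> R) : (j < N)%N ->
  \sum_(l \in partition_box N) (if (size (parts l) <= j.+1)%N then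
    \det (\matrix_(r < j.+1, c < j.+1) a r (part_index l c))
    * \det (\matrix_(r < j.+1, c < j.+1) b (part_index l r) c) else 0)
  = \det (\matrix_(r, c) \sum_(0 <= k < N + j.+1) a r k * b k c).
Proof.
move=> jN; pose Phi (f : 'I_j.+1 -> nat) :=
  (\prod_r a r (f r)) * \det (\matrix_(r < j.+1, c < j.+1) b (f r) c).
transitivity (\sum_(l \in partition_box N) (if (size (parts l) <= j.+1)%N then
    \sum_(s : 'S_j.+1) Phi (part_index l \o s) else 0)).
  by apply: eq_fsbigr => l _; rewrite det_mul_det_expand.
rewrite sum_partition_box //.
rewrite (_ : \matrix_(r, c) _ = 
    (\matrix_(r < j.+1, k < (N + j).+1) a r k) *m
    (\matrix_(k < (N + j).+1, c < j.+1) b k c)).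
  rewrite det_mulmx_rect; apply: eq_bigr => f _; rewrite /Phi.
  congr (_ * _); first by apply: eq_bigr => r _; rewrite mxE.
  congr (\det _).
  by apply/matrixP => r c; rewrite !mxE.
apply/matrixP => r c; rewrite !mxE big_mkord addnS.
by apply: eq_bigr => k _; rewrite !mxE.
Qed.

(** * Uniform bound on the absolute box sums *)

Lemma norm_det_le (R : realDomainType) (m : nat) (A : 'M[R]_m) :
  `|\det A| <= \sum_(s : 'S_m) \prod_r `|A r (s r)|.
Proof.
apply: le_trans (ler_norm_sum _ _ _) _; apply: ler_sum => s _.
by rewrite normrM normrX normrN1 expr1n mul1r normr_prod.
Qed.

Lemma sum_norm_partition_box_le (R : realDomainType) (j N : nat) (K : R)
    (a : 'I_j.+1 -> nat -> R) (b : nat -> 'I_j.+1 -> R) : (j < N)%N ->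
  (forall r c n, \sum_(0 <= k < n) `|a r k * b k c| <= K) ->
  \sum_(l \in partition_box N) (if (size (parts l) <= j.+1)%N then
    `|\det (\matrix_(r < j.+1, c < j.+1) a r (part_index l c))
      * \det (\matrix_(r < j.+1, c < j.+1) b (part_index l r) c)| else 0)
  <= K ^+ j.+1 *+ #|'S_j.+1|.
Proof.
move=> jN hK; pose Phi (f : 'I_j.+1 -> nat) :=
  \sum_(t : 'S_j.+1) \prod_r `|a r (f r) * b (f r) (t r)|.
have Phi0 f : 0 <= Phi f by apply: sumr_ge0 => t _; apply: prodr_ge0.
apply: (@le_trans _ _ (\sum_(l \in partition_box N)
    (if (size (parts l) <= j.+1)%N then
    \sum_(s : 'S_j.+1) Phi (part_index l \o s) else 0))).
  rewrite !fsbig_finite; try exact: partition_box_finite.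
  apply: ler_sum => l _; case: ifP => // _.
  rewrite det_mul_det_expand.
  apply: le_trans (ler_norm_sum _ _ _) _; apply: ler_sum => s _.
  rewrite normrM normr_prod.
  apply: le_trans (ler_wpM2l _ (norm_det_le _)) _; first exact: prodr_ge0.
  rewrite mulr_sumr; apply: ler_sum => t _; rewrite -big_split /=.
  by apply: ler_prod => r _; rewrite !mxE normrM mulr_ge0 /=.
rewrite sum_partition_box //.
(* With injectivity of [f] dropped, the sum of products factors for each fixed [t] into $j + 1$
   sums, each at most [K]. *)
apply: (@le_trans _ _ (\sum_(f : {ffun 'I_j.+1 -> 'I_(N + j).+1}) Phi (fun r => f r : nat))).
  by rewrite big_mkcond; apply: ler_sum => f _; case: ifP.
rewrite exchange_big /= -sumr_const; apply: ler_sum => t _.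
rewrite -(bigA_distr_bigA (fun r (k : 'I_(N + j).+1) => `|a r k * b k (t r)|)) /=.
rewrite -[X in _ ^+ X]card_ord -prodr_const; apply: ler_prod => r _.
rewrite sumr_ge0 //=.
by have := hK r (t r) (N + j).+1; rewrite big_mkord.
Qed.

(** * From box sums to unordered sums *)

Lemma partition_box_mono (M N : nat) :
  (M <= N)%N -> partition_box M `<=` partition_box N.
Proof.
rewrite /partition_box => MN l /= /andP[lM /allP aM]; rewrite (leq_trans lM MN) /=.
by apply/allP => p /aM /leq_trans; apply.
Qed.

Lemma partition_box_exhaust (S : {fset intpart}) (M : nat) :
  exists2 N : nat, (M <= N)%N & {in S, forall l, partition_box N l}.
Proof.
pose g (l : intpart) := maxn (size (parts l)) (\max_(p <- parts l) p).
exists (maxn M (\max_(l <- S) g l)); first exact: leq_maxl.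
move=> l lS; apply: (@partition_box_mono (g l)).
  by rewrite leq_max; apply/orP; right; apply: leq_bigmax_seq.
rewrite /partition_box /= leq_maxl; apply/allP => p pl.
by rewrite leq_max; apply/orP; right; apply: (@leq_bigmax_seq _ _ _ id).
Qed.

(** The absolute box sums increase and are bounded, hence converge. Past a suitable box the
    remaining absolute mass is below $e/2$, whichever further partitions are added. *)
Lemma unordered_sum_of_bounded (R : realType) (F : intpart -> R) (s K : R) :
  box_sum F s -> (\forall N \near \oo, \sum_(l \in partition_box N) `|F l| <= K) ->
  unordered_sum F s.
Proof.
move=> Fs FK; pose a (N : nat) : R := \sum_(l \in partition_box N) `|F l|.
pose X N := fset_set (partition_box N).
have XE N l : (l \in X N) = (l \in partition_box N).
  by rewrite in_fset_set //; exact: partition_box_finite.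
have aE N : a N = \sum_(l <- X N) `|F l|.
  by rewrite /a fsbig_finite //; exact: partition_box_finite.
have splitE (G : intpart -> R) (S T : {fset intpart}) : (S `<=` T)%fset ->
    \sum_(l <- T) G l = \sum_(l <- S) G l + \sum_(l <- T | l \notin S) G l.
  move=> ST; rewrite (bigID (mem S)) /=; congr (_ + _).
  rewrite -big_filter; apply/perm_big/uniq_perm => [||l].
  - by rewrite filter_uniq // fset_uniq.
  - exact: fset_uniq.
  rewrite mem_filter; have [lS/=|//] := boolP (l \in S).
  exact: (fsubsetP ST).
have le_sum (S T : {fset intpart}) : (S `<=` T)%fset ->
    \sum_(l <- S) `|F l| <= \sum_(l <- T) `|F l|.
  by move=> ST; rewrite (splitE _ _ _ ST) lerDl sumr_ge0.
have a_nd : nondecreasing_seq a.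
  move=> M N MN; rewrite !aE; apply: le_sum; apply/fsubsetP => l.
  by rewrite !XE !inE; apply: partition_box_mono.
have a_cvg : cvgn a by apply: (near_nondecreasing_is_cvgn _ FK); exact: nearW.
have aL := nondecreasing_cvgn_le a_nd a_cvg.
move=> e e0; have e20 : 0 < e / 2 by rewrite divr_gt0.
have [N [aN FN]] : exists N, `|limn a - a N| < e / 2 /\
    `|s - \sum_(l \in partition_box N) F l| < e / 2.
  have /cvgrPdist_lt/(_ _ e20) aN := a_cvg.
  have /cvgrPdist_lt/(_ _ e20) FN := Fs.
  by near \oo => N; exists N; split; near: N.
exists (X N) => S NS.
(* Enclosing [S] in a larger box bounds its excess over box [N] by [a N' - a N], hence by
   [limn a - a N]. *)
have [N' _ SN'] := partition_box_exhaust S N.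
rewrite (splitE _ _ _ NS).
move: FN; rewrite fsbig_finite; last exact: partition_box_finite.
move=> FN; rewrite addrAC (splitr e); apply: le_lt_trans (ler_normD _ _) _.
apply: ltrD; first by rewrite distrC.
apply: le_lt_trans (ler_norm_sum _ _ _) _.
apply: le_lt_trans aN; apply: le_trans (ler_norm _); rewrite lerBrDr.
apply: le_trans (aL N'); rewrite addrC !aE -splitE //.
by apply: le_sum; apply/fsubsetP => l lS; rewrite XE inE; apply: SN'.
Unshelve. all: by end_near. Qed.

(** * Limits of determinants and absolute convergence in the interior *)

Lemma cvg_det (R : realType) (m : nat) (A : nat -> 'M[R]_m) (L : 'M[R]_m) :
  (forall r c, A n r c @[n --> \oo] --> L r c) ->
  \det (A n) @[n --> \oo] --> \det L.
Proof.
move=> AL; apply: cvg_big => [|s _]; first exact: add_continuous.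
apply: cvgM; first exact: cvg_cst.
by apply: cvg_big => [|r _]; [exact: mul_continuous | exact: AL].
Qed.

(** Around an interior point, [I] contains some [z] farther from 0. Convergence of the power series
    at [z] forces absolute convergence at every smaller modulus. *)
Lemma maclaurin_abs_cvg (R : realType) (I : set R) (f : R -> R) (x : R) :
  maclaurin_on I f -> I° x -> cvgn (series (fun k => `|maclaurin_term I f x k|)).
Proof.
move=> hf /nbhs_ballP[e /= e0 xe].
have [z Iz xz] : exists2 z, I z & `|x| < `|z|.
  have e2 : 0 < e / 2 by rewrite divr_gt0.
  have e2e : e / 2 < e by rewrite ltr_pdivrMr // ltr_pMr // ltr1n.
  have [x0|x0] := leP 0 x.
    exists (x + e / 2).
      by apply: xe; rewrite /ball /= opprD addrA subrr sub0r normrN gtr0_norm.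
    by rewrite !ger0_norm ?ltrDl // addr_ge0 // ltW.
  exists (x - e / 2).
    by apply: xe; rewrite /ball /= opprB addrC subrK gtr0_norm.
  have xe0 : x - e / 2 < 0 by rewrite subr_lt0 (lt_trans x0).
  by rewrite !ltr0_norm // opprB ltrDr.
pose c k := derive_in_n I k f 0 / k`!%:R.
have cz : cvgn (pseries c z) by apply/cvg_ex; exists (f z); exact: hf.
have := @is_cvg_pseries_inside_norm _ c z `|x| cz; rewrite normr_id => /(_ xz).
rewrite (_ : pseries _ _ = series (fun k => `|maclaurin_term I f x k|)) //.
congr series; apply/funext => k.
by rewrite /maclaurin_term normrM normrX.
Qed.

(** * Row reversal, the Vandermonde denominator and the factorials *)

Lemma det_rev_rows (R : comNzRingType) (m : nat) (A : 'M[R]_m) :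
  \det (\matrix_(r, c) A (rev_ord r) c) = (-1) ^+ 'C(m, 2) * \det A.
Proof.
rewrite -sign_rev_ord -det_perm -det_mulmx -row_permE; congr (\det _).
by apply/matrixP => r c; rewrite !mxE permE.
Qed.

Lemma vandermonde_neq0 (R : realType) (m : nat) (y : 'I_m -> R) :
  injective y -> vandermonde y != 0.
Proof.
move=> yI; rewrite /vandermonde.
rewrite (_ : \matrix_(r, c) _ =
    \matrix_(r, c) Vandermonde m (\row_(c < m) y c) (rev_ord r) c); last first.
  by apply/matrixP => r c; rewrite !mxE.
rewrite det_rev_rows mulf_neq0 ?signr_eq0 // det_Vandermonde.
apply/prodf_neq0 => r _; apply/prodf_neq0 => c rc; rewrite !mxE subr_eq0.
by apply: contraTneq rc => /yI ->; rewrite ltnn.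
Qed.

(** $C_\lambda$ is the product of the factorials of the column indices, so its inverse can be
    distributed over the columns, turning derivatives into Taylor coefficients. *)
Lemma det_part_index (R : fieldType) (j : nat) (d : 'I_j -> nat -> R) (l : intpart) :
  (Cpart j l)%:R^-1 * \det (\matrix_(r < j, c < j) d r (part_index l c))
  = \det (\matrix_(r < j, c < j) (d r (part_index l c) / (part_index l c)`!%:R)).
Proof.
pose w : 'rV[R]_j := \row_c (part_index l c)`!%:R^-1.
rewrite [X in _ = \det X](_ : _ = (\matrix_(r, c) d r (part_index l c)) *m diag_mx w).
  rewrite det_mulmx det_diag mulrC; congr (_ * _).
  rewrite /Cpart natr_prod -prodfV; apply: eq_bigr => c _.
  by rewrite mxE.
by rewrite mul_mx_diag; apply/matrixP => r c; rewrite !mxE.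
Qed.

(** * The Schur series of a determinant of power series *)

Section PartitionSeries.
Context {R : realType} (j : nat).
Variables (d : 'I_j.+1 -> nat -> R) (y : 'I_j.+1 -> R).

Let term (l : intpart) : R :=
  (Cpart j.+1 l)%:R^-1 * \det (\matrix_(r < j.+1, c < j.+1) d r (part_index l c))
    * schur l y.
Let a (r : 'I_j.+1) (k : nat) : R := d r k / k`!%:R.
Let b (k : nat) (c : 'I_j.+1) : R := y c ^+ k.
(** The factor common to all terms: the Schur denominator, and the sign of reversing the rows of its
    numerator. *)
Let kappa : R := (-1) ^+ 'C(j.+1, 2) / vandermonde y.

Lemma schur_term_minors (l : intpart) :
  term l = kappa * (if (size (parts l) <= j.+1)%N then
    \det (\matrix_(r < j.+1, c < j.+1) a r (part_index l c))
    * \det (\matrix_(r < j.+1, c < j.+1) b (part_index l r) c) else 0).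
Proof.
rewrite /term /schur; case: ifP => _; last by rewrite !mulr0.
rewrite det_part_index [RHS]mulrCA; congr (_ * _).
rewrite /kappa mulrAC; congr (_ / _); rewrite -det_rev_rows; congr (\det _).
by apply/matrixP => r c; rewrite !mxE /b /part_index rev_ordK.
Qed.

Lemma partition_sum_minors (uncond : Prop) (v : 'I_j.+1 -> 'I_j.+1 -> R) :
  (forall r c, series (fun k => d r k / k`!%:R * y c ^+ k) @ \oo --> v r c) ->
  (uncond -> forall r c,
    cvgn (series (fun k => `|d r k / k`!%:R * y c ^+ k|))) ->
  partition_sum uncond term (kappa * \det (\matrix_(r, c) v r c)).
Proof.
move=> dv abs.
have box : box_sum term (kappa * \det (\matrix_(r, c) v r c)).
  have : kappa * \det (\matrix_(r, c) \sum_(0 <= k < N + j.+1) a r k * b k c)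
      @[N --> \oo] --> kappa * \det (\matrix_(r, c) v r c).
    apply: cvgMr; apply: cvg_det => r c; rewrite mxE.
    under eq_cvg do rewrite mxE.
    (* Truncation at $N + j + 1$ in place of $N$ is a shift, which leaves the limit unchanged. *)
    by have := dv r c; rewrite -(cvg_shiftn j.+1).
  apply: cvg_trans; apply: near_eq_cvg; near=> N.
  rewrite -cauchy_binet_partition_box; last by near: N; exact: nbhs_infty_gt.
  rewrite !fsbig_finite; try exact: partition_box_finite.
  by rewrite mulr_sumr; apply: eq_bigr => l _; rewrite schur_term_minors.
split=> // /abs {}abs.
(* All the limits are nonnegative, so their sum is one bound valid for every entry. *)
pose K := \sum_r \sum_c limn (series (fun k => `|a r k * b k c|)).
have lim0 r c : 0 <= limn (series (fun k => `|a r k * b k c|)).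
  apply: limr_ge; first exact: abs.
  by apply: nearW => n; apply: sumr_ge0.
have hK r c n : \sum_(0 <= k < n) `|a r k * b k c| <= K.
  apply: le_trans (nondecreasing_cvgn_le _ (abs r c) n) _.
    by apply: nondecreasing_series => k _ _; exact: normr_ge0.
  rewrite /K (bigD1 r) //= (bigD1 c) //= -addrA lerDl addr_ge0 //.
    by apply: sumr_ge0.
  by apply: sumr_ge0 => r' _; apply: sumr_ge0.
apply: (@unordered_sum_of_bounded _ _ _ (`|kappa| * (K ^+ j.+1 *+ #|'S_j.+1|))) => //.
near=> N.
have jN : (j < N)%N by near: N; exact: nbhs_infty_gt.
apply: le_trans (ler_wpM2l (normr_ge0 kappa) (sum_norm_partition_box_le jN hK)).
rewrite !fsbig_finite; try exact: partition_box_finite.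
rewrite mulr_sumr; apply: ler_sum => l _; rewrite schur_term_minors normrM.
by case: ifP; rewrite ?normr0.
Unshelve. all: by end_near. Qed.

End PartitionSeries.

Lemma abs_point_cvg (R : realType) (I : set R) (n : nat) (f : 'I_n -> R -> R) (x : R) :
  (forall k, maclaurin_on I (f k)) -> abs_point I f x ->
  forall k, cvgn (series (fun p => `|maclaurin_term I (f k) x p|)).
Proof. by move=> hf [Ix k|//]; exact: maclaurin_abs_cvg. Qed.

(** * Both formulas from one choice of functions and points *)

Theorem theorem1 (R : realType) (I : set R) (hI : is_interval I) (hI0 : I 0)
  (n : nat) (f : 'I_n -> R -> R)
  (hanalytic : forall k : 'I_n, analytic_on I (f k))
  (hmaclaurin : forall k : 'I_n, maclaurin_on I (f k))
  (x : 'I_n -> R) (hxI : forall r : 'I_n, I (x r))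
  (hx : forall r s : 'I_n, (r < s)%N -> x r < x s)
  (i j : nat) (hj : (0 < j)%N) (hji : (j <= i)%N) (hin : (i <= n)%N) :
  let M := collocation f x in
  let Wt := wronskian_tr I f in
  let hjn := leq_trans hji hin in
  let last_rows := window hji hin in
  let first_rows := window (leqnn j) hjn in
  (exists2 S : R,
     partition_sum (forall r : 'I_j, abs_point I f (x (last_rows r)))
       (fun l => (Cpart j l)%:R^-1 * part_minor (leqnn j) hjn Wt l
                 * schur l (x \o last_rows)) S &
     \det (mxsub last_rows first_rows M)
       = (-1) ^+ 'C(j, 2) * vandermonde (x \o last_rows) * S)
  /\
  (exists2 S : R,
     partition_sum (forall r : 'I_j, abs_point I f (x (first_rows r)))
       (fun l => (Cpart j l)%:R^-1 * part_minor hji hin Wt l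
                 * schur l (x \o first_rows)) S &
     \det (mxsub last_rows first_rows M^T)
       = (-1) ^+ 'C(j, 2) * vandermonde (x \o first_rows) * S).
Proof.
case: j hj hji => // j _ hji M Wt hjn last_rows first_rows.
have x_inj : injective x.
  move=> r s xrs; apply/val_inj; case: (ltngtP r s) => // /hx.
    by rewrite xrs ltxx.
  by rewrite xrs ltxx.
have window_inj (k : nat) (hjk : (j.+1 <= k)%N) (hkn : (k <= n)%N) :
    injective (window hjk hkn).
  by move=> r s /(congr1 val) /addnI /val_inj.
(* [g] picks the functions and [p] the points. Only [p] has to be injective, to keep the Vandermonde
   determinant nonzero. *)
have main (g p : 'I_j.+1 -> 'I_n) : injective p ->
  exists2 S : R, partition_sum (forall r, abs_point I f (x (p r)))
    (fun l => (Cpart j.+1 l)%:R^-1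
      * \det (\matrix_(r < j.+1, c < j.+1) Wt (g r) (part_index l c))
      * schur l (x \o p)) S &
    \det (\matrix_(r < j.+1, c < j.+1) f (g r) (x (p c)))
      = (-1) ^+ 'C(j.+1, 2) * vandermonde (x \o p) * S.
  move=> p_inj; pose v r c := f (g r) (x (p c)).
  exists ((-1) ^+ 'C(j.+1, 2) / vandermonde (x \o p) * \det (\matrix_(r, c) v r c)).
    apply: (@partition_sum_minors _ _ (fun r => Wt (g r)) (x \o p) _ v).
      by move=> r c; exact: (hmaclaurin (g r) _ (hxI (p c))).
    by move=> xabs r c; exact: (abs_point_cvg hmaclaurin (xabs c)).
  have V0 := vandermonde_neq0 (inj_comp x_inj p_inj).
  (* The Vandermonde factors cancel and the two signs multiply to 1. *)
  rewrite mulrA mulrACA divff // mulr1.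
  by rewrite -expr2 sqrr_sign mul1r.
split; last first.
  have [S hS e] := main last_rows first_rows (window_inj _ _ _).
  exists S => //; rewrite -e; congr (\det _).
  by apply/matrixP => r c; rewrite !mxE.
(* In [M] the points index the rows, whereas in [main] they index the columns; hence the
   transposition here. *)
have [S hS e] := main first_rows last_rows (window_inj _ _ _).
exists S => //; rewrite -e -det_tr; congr (\det _).
by apply/matrixP => r c; rewrite !mxE.
Qed.
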